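(* Let $G$ be a discrete Abelian group with neutral element $0$, and let $\Omega_+,\Omega_-\subseteq G$ be symmetric sets ($\Omega_\pm=-\Omega_\pm$) with $0\in\Omega_+$. Let $\rho,\sigma\in\ell^\infty(G;\mathbb{R})$, where $\sigma$ is strictly positive definite and $\rho$ is even. Let $X=\ell^1(G;\mathbb{R})$, let $P\subseteq X$ be the cone of positive definite functions in $X$, and, writing $\Omega_\pm^c:=G\setminus\Omega_\pm$, let \[ Q:=\{f\in X : f|_{\Omega_+^c}\le 0,\ f|_{\Omega_-^c}\ge 0\}. \] Then \[ \inf\{\langle f,\rho\rangle : f\in P\cap Q,\ \langle f,\sigma\rangle=1\}=\sup\{s\in\mathbb{R} : \rho-s\sigma\in P^*+Q^*\}. \]
   Context: $\ell^1(G;\mathbb{R})$ is the Banach space of real-valued summable functions on $G$; its topological dual is identified with $\ell^\infty(G;\mathbb{R})$ via $\langle f,\varphi\rangle=\sum_{g\in G} f(g)\varphi(g)$. For a subset $C$ of a real topological vector space $E$ with topological dual $E'$, the dual cone is $C^*:=\{\varphi\in E' : \langle c,\varphi\rangle\ge 0 \text{ for every } c\in C\}$. A function $f:G\to\mathbb{C}$ is positive definite if $\sum_{k,l=1}^n c_k\overline{c_l}\,f(x_k-x_l)\ge 0$ for all $n\in\mathbb{N}$, $c_k\in\mathbb{C}$, $x_k\in G$. $\varphi$ is even if $\varphi(-g)=\varphi(g)$ for all $g$. $\sigma\in\ell^\infty(G;\mathbb{R})$ is strictly positive definite if $\sigma$ is a positive definite function and $\langle f,\sigma\rangle>0$ for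 every nonzero $f\in P$. Conventions: $\inf\emptyset=\infty$, $\sup\emptyset=-\infty$. *)

(* Defs.v *)
From HB Require Import structures.
From mathcomp Require Import all_boot all_order all_algebra.
From mathcomp Require Import complex.
From mathcomp Require Import all_classical all_reals all_analysis.

Set Implicit Arguments.
Unset Strict Implicit.
Unset Printing Implicit Defensive.

Import Order.TTheory GRing.Theory Num.Theory.
Import numFieldNormedType.Exports.

Local Open Scope classical_set_scope.
Local Open Scope ring_scope.

Definition ell1 (R : realType) (G : zmodType) : set (G -> R) :=
  [set f : G -> R | summable [set: G] (EFin \o f)].

Definition ellinfty (R : realType) (G : zmodType) : set (G -> R) :=
  bounded_fun.

(* The library's [\esum] is meant for nonnegative families, so the unordered
   sum of a real family is taken as the difference of the sums of its positive
   and negative parts; both are finite when [f] is in ell1 and [phi] is in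
   ellinfty. *)
Definition pairing (R : realType) (G : zmodType) (f phi : G -> R) : R :=
  let h : G -> \bar R := fun g => (f g * phi g)%:E in
  fine (\esum_(g in [set: G]) (h^\+)%E g) -
  fine (\esum_(g in [set: G]) (h^\-)%E g).

(* The order on [R[i]] is the partial one: [0 <= z] means that [z] is real and
   nonnegative. *)
Definition positive_definite (R : realType) (G : zmodType)
    (f : G -> R[i]) : Prop :=
  forall (n : nat) (c : 'I_n -> R[i]) (x : 'I_n -> G),
    0 <= \sum_(k < n) \sum_(l < n) c k * (c l)^* * f (x k - x l).

Definition real_positive_definite (R : realType) (G : zmodType)
    (f : G -> R) : Prop :=
  positive_definite (fun g => (f g)%:C%C).

Definition coneP (R : realType) (G : zmodType) : set (G -> R) :=
  [set f : G -> R | ell1 f /\ real_positive_definite f].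
Arguments coneP : clear implicits.

Definition coneQ (R : realType) (G : zmodType) (Omegap Omegam : set G) :
    set (G -> R) :=
  [set f | [/\ ell1 f,
               forall g, (~` Omegap) g -> f g <= 0 &
               forall g, (~` Omegam) g -> 0 <= f g]].

(* The topological dual of ell1 is identified with ellinfty through
   [pairing]. *)
Definition dual_cone (R : realType) (G : zmodType) (C : set (G -> R)) :
    set (G -> R) :=
  [set phi : G -> R | ellinfty phi /\ forall c, C c -> 0 <= pairing c phi].

Definition minkowski_sum (R : realType) (G : zmodType) (A B : set (G -> R)) :
    set (G -> R) :=
  [set a \+ b | a in A & b in B].

Definition symmetric_set (G : zmodType) (Omega : set G) : Prop :=
  Omega = [set - g | g in Omega].

Definition even_function (R : realType) (G : zmodType) (phi : G -> R) : Prop :=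
  forall g, phi (- g) = phi g.

Definition strictly_positive_definite (R : realType) (G : zmodType)
    (sigma : G -> R) : Prop :=
  [/\ ellinfty sigma, real_positive_definite sigma &
      forall f, coneP R G f -> f <> cst 0 -> 0 < pairing f sigma].

(* Main.v *)
Require Import Defs.
From HB Require Import structures.
From mathcomp Require Import all_boot all_order all_algebra.
From mathcomp Require Import complex.
From mathcomp Require Import all_classical all_reals all_analysis.
From mathcomp Require Import ring lra.

Set Implicit Arguments.
Unset Strict Implicit.
Unset Printing Implicit Defensive.

Import Order.TTheory GRing.Theory Num.Theory.
Import numFieldNormedType.Exports.

Local Open Scope classical_set_scope.
Local Open Scope ring_scope.

(* Weak duality is immediate. For the converse it suffices to show that
   [phi := rho - s sigma] lies in [P^* + Q^*] as soon as it is nonnegative on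
   [P `&` Q]. Write [f >= 0] for "all real quadratic forms
   [sum_(k, l) c_k c_l f (x_k - x_l)] are nonnegative"; a function belongs to
   [P] iff it is summable, even and [>= 0]. By Schur's test
   [||f|| delta_0 + f >= 0] for all summable [f], and [delta_0] lies in [Q]: it
   plays the role of a Slater point. Hence
   [N f := inf {<q, phi> : q in Q, q - f >= 0}] is finite and sublinear, with
   [|N f| <= ||f|| phi(0)], and the Hahn-Banach theorem gives a linear [L <= N].
   Being bounded, [L] is the pairing with some [p] in [ellinfty]; [L <= N]
   yields [p] in [P^*] (take [q = 0]) and [phi - p] in [Q^*] (take [q = f]). *)

(** * Unordered sums of summable real families *)

Section unordered_sums.
Context {R : realType} {I : choiceType}.
Implicit Types (f g u v : I -> R).

Definition rsummable f := summable [set: I] (EFin \o f).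

(** Same shape as [pairing]: [pairing f phi] is convertible to [rsum] of the pointwise product, so
    facts about sums transfer to pairings. *)
Definition rsum f : R :=
  let h : I -> \bar R := EFin \o f in
  fine (\esum_(i in [set: I]) (h^\+)%E i) -
  fine (\esum_(i in [set: I]) (h^\-)%E i).

Lemma rsummable_le f g : (forall i, `|f i| <= `|g i|) ->
  rsummable g -> rsummable f.
Proof.
by move=> fg; apply: le_lt_trans; apply: le_esum => i _; rewrite lee_fin.
Qed.

Lemma rsummableD f g : rsummable f -> rsummable g -> rsummable (f \+ g).
Proof. exact: summableD. Qed.

Lemma ge0_esumZl (a : I -> \bar R) (r : R) : 0 <= r -> (forall i, 0 <= a i)%E ->
  (\esum_(i in [set: I]) (r%:E * a i) = r%:E * \esum_(i in [set: I]) a i)%E.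
Proof.
move=> r0 a0; rewrite /esum -ereal_supZl//; last first.
  by apply/set0P; exists (\sum_(x \in set0) a x)%E; exists set0 => //;
    exact: fsets_set0.
congr ereal_sup; apply/seteqP; split=> [_ [A SA <-]|_ [_ [A SA <-] <-]].
  by exists (\sum_(x \in A) a x)%E; [exists A|rewrite ge0_mule_fsumr].
by exists A => //; rewrite ge0_mule_fsumr.
Qed.

Lemma rsummableZ (r : R) f : rsummable f -> rsummable (r \*: f).
Proof.
rewrite /rsummable /summable => sf.
rewrite (@eq_esum _ _ _ _ (fun i => `|r|%:E * `|(f i)%:E|)%E).
  by rewrite ge0_esumZl// lte_mul_pinfty// ?lee_fin.
by move=> i _; rewrite /= normrM EFinM.
Qed.

Lemma ge0_rsumE f : (forall i, 0 <= f i) ->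
  rsum f = fine (\esum_(i in [set: I]) (f i)%:E).
Proof.
move=> f0; rewrite /rsum [X in _ - fine X]esum1 ?subr0 => [|i _].
  congr fine; apply: eq_esum => i _.
  by rewrite funeposE /= -EFin_max; congr EFin; apply/max_idPl.
by rewrite funenegE /= -EFin_max; congr EFin; apply/max_idPr; rewrite oppr_le0.
Qed.

Lemma ge0_esum_fin_num (a : I -> \bar R) : (forall i, 0 <= a i)%E ->
  summable [set: I] a -> (\esum_(i in [set: I]) a i)%E \is a fin_num.
Proof.
move=> a0; rewrite summableE (@eq_esum _ _ _ _ a)// => i _.
by rewrite gee0_abs.
Qed.

Lemma ge0_rsummable f : (forall i, 0 <= f i) -> rsummable f ->
  (\esum_(i in [set: I]) (f i)%:E)%E = (rsum f)%:E.
Proof.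
by move=> f0 sf; rewrite ge0_rsumE// fineK//; exact: ge0_esum_fin_num.
Qed.

Lemma ge0_rsumD u v : (forall i, 0 <= u i) -> (forall i, 0 <= v i) ->
  rsummable u -> rsummable v -> rsum (u \+ v) = rsum u + rsum v.
Proof.
move=> u0 v0 su sv; apply: EFin_inj; rewrite [RHS]EFinD -!ge0_rsummable//.
- by rewrite -esumD// => i _; rewrite lee_fin.
- by move=> i /=; rewrite addr_ge0.
- exact: rsummableD.
Qed.

Lemma ge0_rsumB u v : (forall i, 0 <= u i) -> (forall i, 0 <= v i) ->
  rsummable u -> rsummable v -> rsum (u \- v) = rsum u - rsum v.
Proof.
move=> u0 v0 su sv; apply: EFin_inj;
  rewrite [RHS]EFinB -(ge0_rsummable u0)// -(ge0_rsummable v0)//.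
rewrite -(@esumB _ _ _ (EFin \o u) (EFin \o v))//; last 2 first.
- by move=> i _; rewrite lee_fin.
- by move=> i _; rewrite lee_fin.
have E : EFin \o (u \- v) = ((EFin \o u) \- (EFin \o v))%E by apply/funext.
have suv : rsummable (u \- v) by rewrite /rsummable E; exact: summableB.
rewrite /rsum E EFinB !fineK//; rewrite -E.
  by apply: ge0_esum_fin_num => //; exact: summable_funeneg.
by apply: ge0_esum_fin_num => //; exact: summable_funepos.
Qed.

Let pos f i := Num.max (f i) 0.
Let neg f i := Num.max (- f i) 0.

Let pos_ge0 f i : 0 <= pos f i. Proof. by rewrite le_max lexx orbT. Qed.
Let neg_ge0 f i : 0 <= neg f i. Proof. by rewrite le_max lexx orbT. Qed.

Let posBneg f : pos f \- neg f = f.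
Proof.
apply/funext => i; rewrite /pos /neg /=.
by case: (leP (f i) 0) => ?; case: (leP (- f i) 0) => ?; lra.
Qed.

Let rsummable_pos f : rsummable f -> rsummable (pos f).
Proof.
apply: rsummable_le => i; rewrite ger0_norm// /pos ge_max normr_ge0.
by rewrite ler_norm.
Qed.

Let rsummable_neg f : rsummable f -> rsummable (neg f).
Proof.
apply: rsummable_le => i; rewrite ger0_norm// /neg ge_max normr_ge0.
by rewrite -normrN ler_norm.
Qed.

(** Positive parts are not additive. Hence [f \+ g] is regrouped as a difference of the nonnegative
    families [pos f \+ pos g] and [neg f \+ neg g], to which [ge0_rsumB] applies even though their
    supports may overlap. *)
Lemma rsumD f g : rsummable f -> rsummable g ->
  rsum (f \+ g) = rsum f + rsum g.
Proof.
move=> sf sg; rewrite -(posBneg f) -(posBneg g).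
have spf := rsummable_pos sf; have snf := rsummable_neg sf.
have spg := rsummable_pos sg; have sng := rsummable_neg sg.
rewrite [in RHS]ge0_rsumB// [in RHS]ge0_rsumB//.
have -> : pos f \- neg f \+ (pos g \- neg g) =
  (pos f \+ pos g) \- (neg f \+ neg g).
  by apply/funext => i /=; ring.
rewrite ge0_rsumB ?ge0_rsumD//; first by ring.
all: by [move=> i; apply: addr_ge0|exact: rsummableD].
Qed.

Lemma ge0_rsumZ (r : R) f : (forall i, 0 <= f i) -> 0 <= r -> rsummable f ->
  rsum (r \*: f) = r * rsum f.
Proof.
move=> f0 r0 sf; apply: EFin_inj; rewrite [RHS]EFinM -!ge0_rsummable//.
- by rewrite -ge0_esumZl// => i; rewrite lee_fin.
- by move=> i /=; exact: mulr_ge0.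
- exact: rsummableZ.
Qed.

Lemma rsum0 : rsum (fun=> 0) = 0.
Proof. by rewrite ge0_rsumE// esum1. Qed.

Lemma rsumZ (r : R) f : rsummable f -> rsum (r \*: f) = r * rsum f.
Proof.
wlog r0 : r / 0 <= r => [H sf|].
  have [r0|/ltW r0] := leP 0 r; first exact: H.
  (* A negative scalar is reduced to a positive one through [r f + (- r) f = 0]. *)
  have := rsumD (rsummableZ r sf) (rsummableZ (- r) sf).
  rewrite (H (- r)) ?oppr_ge0//.
  have -> : (r \*: f) \+ (- r \*: f) = (fun=> 0).
    by apply/funext => i /=; rewrite -scalerDl subrr scale0r.
  by rewrite rsum0 mulNr => /esym/eqP; rewrite subr_eq0 => /eqP.
move=> sf; rewrite -{1}(posBneg f).
have spf := rsummable_pos sf; have snf := rsummable_neg sf.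
have -> : r \*: (pos f \- neg f) = (r \*: pos f) \- (r \*: neg f).
  by apply/funext => i /=; rewrite scalerBr.
rewrite ge0_rsumB ?ge0_rsumZ//.
- by rewrite -mulrBr -ge0_rsumB// posBneg.
- by move=> i; apply: mulr_ge0.
- by move=> i; apply: mulr_ge0.
- exact: rsummableZ.
- exact: rsummableZ.
Qed.

Lemma rsum_ge0 f : (forall i, 0 <= f i) -> 0 <= rsum f.
Proof.
by move=> f0; rewrite ge0_rsumE// fine_ge0// esum_ge0// => i _; rewrite lee_fin.
Qed.

Lemma ler_rsum f g : rsummable f -> rsummable g -> (forall i, f i <= g i) ->
  rsum f <= rsum g.
Proof.
move=> sf sg fg; have -> : g = f \+ (g \+ (-1 \*: f)).
  by apply/funext => i /=; rewrite scaleN1r; ring.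
have sNf := rsummableZ (-1) sf.
rewrite rsumD//; last exact: rsummableD.
by rewrite lerDl rsum_ge0// => i /=; rewrite scaleN1r subr_ge0.
Qed.

Lemma rsummable_abs f : rsummable f -> rsummable (fun i => `|f i|).
Proof. by apply: rsummable_le => i; rewrite normr_id. Qed.

Lemma ler_abs_rsum f : rsummable f -> `|rsum f| <= rsum (fun i => `|f i|).
Proof.
move=> sf; have saf := rsummable_abs sf.
rewrite ler_norml -mulN1r -rsumZ// !ler_rsum//.
- by move=> i; exact: ler_norm.
- exact: rsummableZ.
- by move=> i /=; rewrite scaleN1r lerNl -normrN ler_norm.
Qed.

Definition delta (j : I) : I -> R := fun i => (i == j)%:R.

Let esum_delta j : (\esum_(i in [set: I]) (delta j i)%:E = 1)%E.
Proof.
rewrite -(@esum_set1 _ _ j (fun=> 1%E))// [RHS]esum_mkcond.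
apply: eq_esum => i _; rewrite /delta; case: eqVneq => [->|ij].
  by rewrite mem_set.
by rewrite memNset// => /eqP; exact/negP.
Qed.

Lemma rsummable_delta j : rsummable (delta j).
Proof.
rewrite /rsummable /summable (@eq_esum _ _ _ _ (fun i => (delta j i)%:E)).
  by rewrite esum_delta ltry.
by move=> i _ /=; rewrite ger0_norm.
Qed.

Lemma rsum_delta j : rsum (delta j) = 1.
Proof. by rewrite ge0_rsumE ?esum_delta// => i; rewrite ler0n. Qed.

(** Built from Dirac functions so that a linear functional can be evaluated on it term by term; for
    a duplicate-free [s] it is [f] cut off outside [s]. *)
Definition truncation (s : seq I) f : I -> R := \sum_(j <- s) (f j *: delta j).

Lemma truncationE (s : seq I) f i : uniq s ->
  truncation s f i = (i \in s)%:R * f i.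
Proof.
move=> us; rewrite /truncation fct_sumE.
under eq_bigr => j _ do rewrite [(_ *: _) i](_ : _ = f j * (i == j)%:R)//.
have [si|si] := boolP (i \in s).
  rewrite (bigD1_seq i)//= eqxx big1 => [|j ji];
    first by rewrite mulr1 mul1r addr0.
  by rewrite eq_sym (negbTE ji) mulr0.
rewrite mul0r big1_seq// => j /= js.
by case: eqVneq => [ij|_]; [move: si; rewrite ij js|rewrite mulr0].
Qed.

Lemma rsummable0 : rsummable (fun=> 0).
Proof. by rewrite /rsummable /summable esum1// => i _; rewrite /= normr0. Qed.

Lemma rsummable_rsum_truncation (s : seq I) f :
  rsummable (truncation s f) /\ rsum (truncation s f) = \sum_(j <- s) f j.
Proof.
rewrite /truncation; elim: s => [|j s [IH1 IH2]].
  by rewrite !big_nil; split; [exact: rsummable0|exact: rsum0].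
have sj := rsummableZ (f j) (rsummable_delta j).
rewrite !big_cons; split; first exact: rsummableD.
rewrite rsumD// IH2 [X in X + _](rsumZ _ (rsummable_delta j)).
by rewrite rsum_delta mulr1.
Qed.

Lemma ler_sum_rsum (s : seq I) f : rsummable f -> uniq s ->
  (forall i, 0 <= f i) -> \sum_(j <- s) f j <= rsum f.
Proof.
move=> sf us f0; have [st <-] := rsummable_rsum_truncation s f.
apply: ler_rsum => // i; rewrite truncationE//.
by case: (i \in s); rewrite ?mul1r// mul0r.
Qed.

(** Some finite partial sum of [|f|] exceeds the total minus [e], and what remains is the norm of
    the tail of [f]. *)
Lemma rsum_approx f (e : R) : rsummable f -> 0 < e ->
  exists2 s : seq I, uniq s &
    rsum (fun i => `|f i - truncation s f i|) <= e.
Proof.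
move=> sf e0; have saf := rsummable_abs sf.
have := @ge0_rsummable (fun i => `|f i|) (fun=> normr_ge0 _) saf.
rewrite /esum => Es.
have : ((rsum (fun i => `|f i|) - e)%:E <
    ereal_sup [set (\sum_(x \in A) `|f x|%:E)%E | A in fsets [set: I]])%E.
  by rewrite Es lte_fin ltrBlDr ltrDl.
move=> /ereal_sup_gt[_ [A [finA _] <-]]; rewrite fsumEFin// fsbig_finite//=.
set s := finmap.enum_fset _ => lt_s; exists s; first exact: finmap.fset_uniq.
have us : uniq s by exact: finmap.fset_uniq.
have [st et] := rsummable_rsum_truncation s (fun i => `|f i|).
rewrite (_ : (fun i => _) =
    (fun i => `|f i|) \+ (-1 \*: truncation s (fun i => `|f i|))).
  rewrite rsumD ?rsumZ ?et ?mulN1r//; last exact: rsummableZ.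
  by move: lt_s; rewrite lte_fin; lra.
apply/funext => i /=; rewrite !truncationE//; case: (i \in s).
  by rewrite !mul1r scaleN1r !subrr normr0.
by rewrite !mul0r scaler0 subr0 addr0.
Qed.

(** By linearity [T] vanishes on truncations, which are dense, and the bound by [K] makes it
    continuous. This serves to recognize a bounded functional from its values on Dirac functions. *)
Lemma rsummable_functional_eq0 (T : (I -> R) -> R) (K : R) :
  (forall r f g, rsummable f -> rsummable g ->
    T (r *: f + g) = r * T f + T g) ->
  (forall f, rsummable f -> `|T f| <= K * rsum (fun i => `|f i|)) ->
  (forall j, T (delta j) = 0) ->
  forall f, rsummable f -> T f = 0.
Proof.
move=> Tlin Tbd Tdelta f sf.
have T0 : T 0 = 0.
  by have := Tlin 1 _ _ rsummable0 rsummable0; rewrite scaler0 addr0 => ?; lra.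
have Ttr s : T (truncation s f) = 0.
  rewrite /truncation; elim: s => [|j s IH]; first by rewrite big_nil.
  rewrite big_cons Tlin ?Tdelta ?IH ?mulr0 ?addr0//.
    exact: rsummable_delta.
  exact: (rsummable_rsum_truncation s f).1.
apply/eqP; rewrite -normr_eq0 eq_le normr_ge0 andbT.
apply/ler_addgt0Pl => e e0; rewrite addr0.
(* [K] carries no sign; [|K| + 1] is a positive substitute by which [e] can be divided. *)
have K1 : 0 < `|K| + 1 by rewrite ltr_wpDl.
have [s us hs] := rsum_approx sf (divr_gt0 e0 K1).
have [st _] := rsummable_rsum_truncation s f.
have sd : rsummable (f - truncation s f).
  by rewrite -scaleN1r; apply: rsummableD => //; exact: rsummableZ.
have -> : T f = T (f - truncation s f).
  by rewrite addrC -scaleN1r Tlin// Ttr mulr0 add0r.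
apply: (le_trans (Tbd _ sd)).
have dist0 : 0 <= rsum (fun i => `|(f - truncation s f) i|) by exact: rsum_ge0.
apply: (@le_trans _ _ ((`|K| + 1) * rsum (fun i => `|(f - truncation s f) i|))).
  by rewrite ler_wpM2r// (le_trans (ler_norm _))// lerDl.
by rewrite -ler_pdivlMl// mulrC.
Qed.

End unordered_sums.

(** * The Hahn-Banach theorem relative to a subspace *)

Section hahn_banach.
Context {R : realType} {V : lmodType R} (D : set V).
Hypothesis D0 : D 0.
Hypothesis Dlin : forall (a : R) u v, D u -> D v -> D (a *: u + v).
Implicit Types (p q : V -> R) (u v : V).

Let DD u v : D u -> D v -> D (u + v).
Proof. by move=> Du Dv; rewrite -[u]scale1r; exact: Dlin. Qed.

Let DZ (a : R) u : D u -> D (a *: u).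
Proof. by move=> Du; rewrite -[_ *: _]addr0; exact: Dlin. Qed.

Let DN u : D u -> D (- u).
Proof. by rewrite -scaleN1r; exact: DZ. Qed.

(** Relative to [D], because the summable functions form a subset of [G -> R] and not a type. The
    reverse homogeneity inequality follows by scaling with [a^-1]. *)
Definition sublinear_on p :=
  (forall u v, D u -> D v -> p (u + v) <= p u + p v) /\
  (forall (a : R) u, 0 < a -> D u -> a * p u <= p (a *: u)).

(** From [0 <= p 0 <= p u + p (- u)]. It bounds all functionals below [N] from below by [- N (- u)],
    so that their pointwise infima are finite. *)
Let sublinear_ge_opp p u : sublinear_on p -> D u -> - p (- u) <= p u.
Proof.
move=> [pD _] Du; have := pD 0 0 D0 D0; have := pD _ _ Du (DN Du).
rewrite subrr addr0; lra.
Qed.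

(** To bound [m (u + v)] by [p u + q v], use the smaller of [p] and [q], available in a chain: it is
    subadditive and lies below both. *)
Let sublinear_inf_chain (A : set (V -> R)) (b : V -> R) p0 : A p0 ->
  (forall p, A p -> sublinear_on p) ->
  (forall p u, A p -> D u -> b u <= p u) ->
  (forall p q, A p -> A q -> (forall u, D u -> p u <= q u) \/
                             (forall u, D u -> q u <= p u)) ->
  let m u := inf [set p u | p in A] in
  sublinear_on m /\ (forall p u, A p -> D u -> m u <= p u).
Proof.
move=> Ap0 Asub Ab Achain m.
have m_le p u : A p -> D u -> m u <= p u.
  move=> Ap Du; apply: ge_inf; last by exists p.
  by exists (b u) => _ [q Aq <-]; exact: Ab.
have le_m c u : (forall p, A p -> c <= p u) -> c <= m u.
  move=> cA; apply: lb_le_inf; first by exists (p0 u), p0.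
  by move=> _ [p Ap <-]; exact: cA.
split=> //; split=> [u v Du Dv|a u a0 Du]; last first.
  apply: (le_m) => p Ap; apply: le_trans ((Asub _ Ap).2 _ _ a0 Du).
  by rewrite ler_pM2l// m_le.
rewrite -lerBlDr; apply: (le_m) => p Ap; rewrite lerBlDr -lerBlDl.
apply: (le_m) => q Aq; rewrite lerBlDl.
have [pq|qp] := Achain _ _ Ap Aq.
  have := pq _ Dv; have := (Asub _ Ap).1 _ _ Du Dv.
  have := m_le _ _ Ap (DD Du Dv); lra.
have := qp _ Du; have := (Asub _ Aq).1 _ _ Du Dv.
have := m_le _ _ Aq (DD Du Dv); lra.
Qed.

(** The witness is the infimum over [t >= 0] of [p (u + t y) - t p y]; [t = 0] and [t = 1] give the
    two bounds. If [p] is minimal then [p <= q], and the second bound turns into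
    [p u + p y <= p (u + y)]. *)
Let sublinear_contract p y : sublinear_on p -> D y ->
  exists q, [/\ sublinear_on q, (forall u, D u -> q u <= p u) &
                forall u, D u -> q u <= p (u + y) - p y].
Proof.
move=> psub Dy; have [pD pZ] := psub.
pose S u := [set p (u + t *: y) - t * p y | t in [set t : R | 0 <= t]].
pose q u := inf (S u).
have lbS u : D u -> lbound (S u) (- p (- u)).
  move=> Du _ [t /= t0 <-].
  have ty : t * p y <= p (t *: y).
    move: t0; rewrite le_eqVlt => /predU1P[<-|t0]; last exact: pZ.
    rewrite mul0r scale0r; have := pD 0 0 D0 D0; rewrite addr0; lra.
  have := pD _ _ (DD Du (DZ t Dy)) (DN Du).
  rewrite [_ + - u]addrC addrA addNr add0r; lra.
have q_le u t : D u -> 0 <= t -> q u <= p (u + t *: y) - t * p y.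
  move=> Du t0; apply: ge_inf; last by exists t.
  by exists (- p (- u)); exact: lbS.
have le_q c u : (forall t, 0 <= t -> c <= p (u + t *: y) - t * p y) -> c <= q u.
  move=> cS; apply: lb_le_inf.
    by exists (p (u + 0 *: y) - 0 * p y), 0 => /=.
  by move=> _ [t t0 <-]; exact: cS.
exists q; split=> [|u Du|u Du].
- split=> [u v Du Dv|a u a0 Du].
    rewrite -lerBlDr; apply: (le_q) => t t0; rewrite lerBlDr -lerBlDl.
    apply: (le_q) => s s0; rewrite lerBlDl.
    have := q_le _ _ (DD Du Dv) (addr_ge0 t0 s0).
    have := pD _ _ (DD Du (DZ t Dy)) (DD Dv (DZ s Dy)).
    by rewrite addrACA -scalerDl mulrDl; lra.
  apply: (le_q) => t t0.
  (* The parameter [t] for [a *: u] corresponds to [a^-1 * t] for [u]. *)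
  have at0 : 0 <= a^-1 * t by rewrite mulr_ge0// invr_ge0 ltW.
  have := q_le u _ Du at0; rewrite -(ler_pM2l a0) => /le_trans; apply.
  rewrite mulrBr !mulrA mulfV ?lt0r_neq0// mul1r lerB//.
  apply: (le_trans (pZ _ _ a0 (DD Du (DZ (a^-1 * t) Dy)))).
  by rewrite scalerDr scalerA mulrA mulfV ?lt0r_neq0// mul1r.
- by have := q_le u 0 Du (lexx _); rewrite scale0r addr0 mul0r subr0.
- by have := q_le u 1 Du ler01; rewrite scale1r mul1r.
Qed.

(* By Zorn's lemma there is a minimal sublinear functional below [N]; minimality
   forces it to be linear. *)
Lemma hahn_banach (N : V -> R) : sublinear_on N ->
  exists L : V -> R,
    (forall (a : R) u v, D u -> D v -> L (a *: u + v) = a * L u + L v) /\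
    (forall u, D u -> L u <= N u).
Proof.
move=> Nsub.
pose T := {p : V -> R | sublinear_on p /\ forall u, D u -> p u <= N u}.
(* The order is reversed, so that a maximal element in Zorn's lemma is a minimal functional and the
   infimum of a chain is an upper bound. *)
pose below (p q : T) := `[< forall u, D u -> sval q u <= sval p u >].
have TN : sublinear_on N /\ forall u, D u -> N u <= N u by [].
have [||A chA|[p [psub pN]] pmin] := @ZL_preorder T (exist _ N TN) below.
- by move=> p; apply/asboolP.
- move=> p q r /asboolP qp /asboolP rp; apply/asboolP => u Du.
  exact: le_trans (rp _ Du) (qp _ Du).
- have [[p0 Ap0]|A0] := pselect (exists t : T, A t); last first.
    by exists (exist _ N TN) => s As; exfalso; apply: A0; exists s.
  have [||p u||] := @sublinear_inf_chain [set sval p | p in A]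
    (fun u => - N (- u)) (sval p0).
  + by exists p0.
  + by move=> _ [p _ <-]; exact: (svalP p).1.
  + move=> [q _ <-] Du; have [qsub qN] := svalP q.
    by apply: le_trans (sublinear_ge_opp qsub Du); rewrite lerN2 qN//;
      exact: DN.
  + move=> _ _ [p Ap <-] [q Aq <-].
    by have [/asboolP|/asboolP] := chA _ _ Ap Aq; [right|left].
  move=> msub m_le; set m := (fun u => inf _) in msub m_le.
  have mN : sublinear_on m /\ forall u, D u -> m u <= N u.
    split=> // u Du; apply: le_trans ((svalP p0).2 _ Du).
    by apply: m_le => //; exists p0.
  exists (exist _ m mN) => s As; apply/asboolP => u Du /=.
  by apply: m_le => //; exists s.
have pmin' q : sublinear_on q -> (forall u, D u -> q u <= p u) ->
    forall u, D u -> p u <= q u.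
  move=> qsub qp.
  have qN : sublinear_on q /\ forall u, D u -> q u <= N u.
    by split=> // u Du; exact: le_trans (qp _ Du) (pN _ Du).
  exact: (asboolW (pmin (exist _ q qN) (asboolT qp))).
have [pD pZ] := psub.
have padd u v : D u -> D v -> p (u + v) = p u + p v.
  move=> Du Dv; apply/eqP; rewrite eq_le pD//=.
  have [q [qsub qp qv]] := sublinear_contract psub Dv.
  by rewrite -lerBrDr (le_trans (pmin' _ qsub qp _ Du))// qv.
have p0 : p 0 = 0 by have := padd 0 0 D0 D0; rewrite addr0; lra.
have popp u : D u -> p (- u) = - p u.
  by move=> Du; have := padd _ _ Du (DN Du); rewrite subrr p0; lra.
have ppos (a : R) u : 0 < a -> D u -> p (a *: u) = a * p u.
  move=> a0 Du; apply/eqP; rewrite eq_le pZ// andbT.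
  have ai0 : 0 < a^-1 by rewrite invr_gt0.
  have := pZ _ _ ai0 (DZ a Du).
  by rewrite scalerA mulVf ?lt0r_neq0// scale1r ler_pdivrMl.
exists p; split=> // a u v Du Dv; rewrite padd//; last exact: DZ.
congr (_ + _); have [a0|a0|->] := ltgtP a 0; last by rewrite scale0r mul0r.
- rewrite -[a]opprK scaleNr popp ?ppos ?mulNr// ?oppr_gt0//; exact: DZ.
- exact: ppos.
Qed.

End hahn_banach.

(** * Real quadratic forms and positive definiteness *)

Section positive_definite.
Context {R : realType} {G : zmodType}.
Implicit Types (f h : G -> R).

Definition qform n (c : 'I_n -> R) (x : 'I_n -> G) f : R :=
  \sum_(k < n) \sum_(l < n) c k * c l * f (x k - x l).

(** Real coefficients see only the even part of [f]; this condition is therefore weaker than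
    [real_positive_definite], and evenness makes up the difference. *)
Definition real_psd f :=
  forall n (c : 'I_n -> R) (x : 'I_n -> G), 0 <= qform c x f.

Lemma qform_lin n (c : 'I_n -> R) (x : 'I_n -> G) (r : R) f h :
  qform c x (r *: f + h) = r * qform c x f + qform c x h.
Proof.
rewrite /qform mulr_sumr -big_split; apply: eq_bigr => k _.
rewrite mulr_sumr -big_split; apply: eq_bigr => l _ /=.
rewrite (_ : (r *: f + h) _ = r * f (x k - x l) + h (x k - x l))//; ring.
Qed.

Lemma qform_reflect n (c : 'I_n -> R) (x : 'I_n -> G) f :
  qform c x (fun g => f (- g)) = qform c x f.
Proof.
rewrite /qform exchange_big; apply: eq_bigr => k _; apply: eq_bigr => l _ /=.
by rewrite opprB [c l * _]mulrC.
Qed.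

(** Test with coefficients [1] and [i] at the points [g] and [0]: the imaginary part of the form is
    [f (- g) - f g], and the order on [R[i]] forces it to vanish. *)
Lemma real_pd_even f : real_positive_definite f -> even_function f.
Proof.
move=> /(_ 2%N (fun k => if val k == 0%N then 1 else 'i%C)) pdf g.
have := pdf (fun k => if val k == 0%N then g else 0).
rewrite !big_ord_recl !big_ord0 /= !addr0 subrr sub0r subr0.
rewrite lecE /= => /andP[/eqP + _].
simpc; lra.
Qed.

Lemma real_pd_psd f : real_positive_definite f -> real_psd f.
Proof.
move=> pdf n c x; have := pdf n (fun k => (c k)%:C%C) x.
rewrite (_ : \sum_k _ = (qform c x f)%:C%C) ?lecR//.
rewrite /qform rmorph_sum; apply: eq_bigr => k _.
rewrite rmorph_sum; apply: eq_bigr => l _ /=.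
by rewrite !rmorphM /=; congr (_ * _ * _); apply/eqP;
  rewrite eq_complex /= oppr0 !eqxx.
Qed.

(* For a real even [f], the Hermitian form at [a + ib] splits as the sum of the
   real forms at [a] and at [b]. *)
Lemma even_psd_real_pd f :
  even_function f -> real_psd f -> real_positive_definite f.
Proof.
move=> evf psdf n c x.
rewrite (_ : \sum_k _ = (qform (fun k => complex.Re (c k)) x f +
                      qform (fun k => complex.Im (c k)) x f)%:C%C).
  by rewrite lecR addr_ge0.
(* The imaginary part of the form; exchanging [k] and [l] swaps its two halves because [f] is
   even. *)
pose im : R := \sum_(k < n) \sum_(l < n)
  (complex.Im (c k) * complex.Re (c l) * f (x k - x l)
    - complex.Re (c k) * complex.Im (c l) * f (x k - x l)).
have im0 : im = 0.
  rewrite /im; under eq_bigr do rewrite sumrB.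
  rewrite sumrB [X in _ - X]exchange_big /=.
  apply/eqP; rewrite subr_eq0; apply/eqP.
  apply: eq_bigr => k _; apply: eq_bigr => l _.
  by rewrite -[x l - x k]opprB evf [_ (c l) * _]mulrC.
transitivity (\sum_(k < n) \sum_(l < n)
   (((complex.Re (c k) * complex.Re (c l) * f (x k - x l)
    + complex.Im (c k) * complex.Im (c l) * f (x k - x l)))%:C
    + 'i * (complex.Im (c k) * complex.Re (c l) * f (x k - x l)
      - complex.Re (c k) * complex.Im (c l) * f (x k - x l))%:C))%C.
  apply: eq_bigr => k _; apply: eq_bigr => l _.
  case: (c k) => a b; case: (c l) => a' b'; apply/eqP.
  rewrite eq_complex; simpc => /=; apply/andP; split; apply/eqP; ring.
under eq_bigr do rewrite big_split /= -mulr_sumr -!rmorph_sum.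
rewrite big_split /= -mulr_sumr -!rmorph_sum -/im im0 rmorph0 mulr0 addr0.
by congr (_%:C)%C; rewrite /qform -big_split; apply: eq_bigr => k _;
  rewrite -big_split.
Qed.

Lemma coneP_psd f : ell1 f -> even_function f -> real_psd f -> coneP R G f.
Proof. by move=> sf evf psdf; split=> //; exact: even_psd_real_pd. Qed.

(* Equal points are collected, so that those of [s] are distinct. *)
Let qform_group n (c : 'I_n -> R) (x : 'I_n -> G) :
  exists (s : seq G) (A : G -> R), uniq s /\ forall f,
    qform c x f = \sum_(y <- s) \sum_(z <- s) A y * A z * f (y - z).
Proof.
pose s := undup (codom x); pose A y := \sum_(k < n | x k == y) c k.
have us : uniq s by exact: undup_uniq.
have xs k : x k \in s by rewrite mem_undup codom_f.
have group (F : 'I_n -> G -> R) :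
    \sum_(k < n) F k (x k) = \sum_(y <- s) \sum_(k < n | x k == y) F k y.
  rewrite (exchange_big_dep xpredT)//=; apply: eq_bigr => k _.
  under eq_bigl do rewrite eq_sym.
  by rewrite -big_filter filter_pred1_uniq// big_seq1.
exists s, A; split=> // f; rewrite /qform.
rewrite (group (fun k y => \sum_l c k * c l * f (y - x l))).
apply: eq_bigr => y _.
under eq_bigr do rewrite (group (fun l z => c _ * c l * f (y - z))).
rewrite exchange_big; apply: eq_bigr => z _ /=.
rewrite /A mulr_suml mulr_suml; apply: eq_bigr => k _.
by rewrite mulr_sumr mulr_suml.
Qed.

(* Schur's test, with [2 |a b| <= a^2 + b^2]: this is what makes the Dirac
   function at [0] interior to the cone of positive definite functions. *)
Lemma real_psd_dirac (M : R) h :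
  (forall s : seq G, uniq s -> \sum_(g <- s) `|h g| <= M) ->
  real_psd (fun g => M * (g == 0)%:R + h g).
Proof.
move=> hM n c x; have [s [A [us ->]]] := qform_group c x.
(* The points of [s] are distinct, so a row or a column of the matrix [h (y - z)] lists values of
   [h] at distinct points, whence the bound [M]. *)
have row y : \sum_(z <- s) `|h (y - z)| <= M.
  rewrite -(big_map (fun z => y - z) xpredT (fun g => `|h g|)) hM//.
  by rewrite map_inj_uniq// => a b /addrI/oppr_inj.
have col z : \sum_(y <- s) `|h (y - z)| <= M.
  rewrite -(big_map (fun y => y - z) xpredT (fun g => `|h g|)) hM//.
  by rewrite map_inj_uniq// => a b /addIr.
have diag y : y \in s ->
    \sum_(z <- s) A y * A z * (M * (y - z == 0)%:R) = M * A y ^+ 2.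
  move=> ys; rewrite (bigD1_seq y)//= subrr eqxx big1 ?addr0.
    by rewrite mulr1n; ring.
  by move=> z zy; rewrite subr_eq0 eq_sym (negbTE zy) !mulr0.
have -> : \sum_(y <- s) \sum_(z <- s)
      A y * A z * (M * (y - z == 0)%:R + h (y - z)) =
    \sum_(y <- s) M * A y ^+ 2 +
    \sum_(y <- s) \sum_(z <- s) A y * A z * h (y - z).
  rewrite -big_split /= !big_seq; apply: eq_bigr => y ys.
  by rewrite -diag// -big_split; apply: eq_bigr => z _; rewrite /= mulrDr.
have lower : - \sum_(y <- s) \sum_(z <- s)
      (A y ^+ 2 / 2 * `|h (y - z)| + A z ^+ 2 / 2 * `|h (y - z)|)
    <= \sum_(y <- s) \sum_(z <- s) A y * A z * h (y - z).
  rewrite -sumrN ler_sum// => y _; rewrite -sumrN ler_sum// => z _.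
  rewrite -mulrDl lerNl -mulNr.
  apply: (le_trans (ler_norm _)); rewrite normrM ler_wpM2r// normrN ler_norml.
  have := sqr_ge0 (A y + A z); have := sqr_ge0 (A y - A z).
  by rewrite sqrrB sqrrD => ? ?; apply/andP; split; lra.
apply: le_trans (lerD (lexx _) lower); rewrite subr_ge0.
under eq_bigr do rewrite big_split /=.
rewrite big_split /= [X in _ + X]exchange_big /= -big_split /=.
apply: ler_sum => y _; rewrite -!mulr_sumr.
have A0 : 0 <= A y ^+ 2 / 2 by rewrite divr_ge0// sqr_ge0.
have := ler_wpM2l A0 (row y); have := ler_wpM2l A0 (col y); lra.
Qed.

End positive_definite.

(** * The pairing between summable and bounded functions *)

Section pairing.
Context {R : realType} {G : zmodType}.
Implicit Types (f h phi psi : G -> R) (M : R).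

Lemma ellinftyP phi : ellinfty phi <-> exists M, forall g, `|phi g| <= M.
Proof.
split=> [[M [_ HM]]|[M HM]].
  (* [bounded_fun] provides only the bounds strictly above [M], hence [M + 1]. *)
  by exists (M + 1) => g; apply: HM => //; rewrite ltrDl.
by exists M; split=> [|M' MM' g _];
  [exact: num_real|exact: le_trans (HM g) (ltW MM')].
Qed.

Lemma ellinftyD phi psi (r : R) : ellinfty phi -> ellinfty psi ->
  ellinfty (fun g => phi g + r * psi g).
Proof.
move=> /ellinftyP[M HM] /ellinftyP[K HK]; apply/ellinftyP.
exists (M + `|r| * K) => g; apply: (le_trans (ler_normD _ _)).
by rewrite lerD// normrM ler_wpM2l.
Qed.

Lemma ell1_mul f phi : ell1 f -> ellinfty phi ->
  rsummable (fun g => f g * phi g).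
Proof.
move=> sf /ellinftyP[M HM]; apply: (rsummable_le _ (rsummableZ M sf)) => g /=.
rewrite !normrM [leRHS]mulrC ler_wpM2l//.
exact: le_trans (HM g) (ler_norm _).
Qed.

Lemma pairing_linl phi (r : R) f h : ellinfty phi -> ell1 f -> ell1 h ->
  pairing (r *: f + h) phi = r * pairing f phi + pairing h phi.
Proof.
move=> bphi sf sh; have sfp := ell1_mul sf bphi; have shp := ell1_mul sh bphi.
transitivity (rsum ((r \*: (fun g => f g * phi g)) \+ (fun g => h g * phi g))).
  by congr rsum; apply/funext => g; rewrite [LHS]mulrDl -mulrA.
by rewrite rsumD ?rsumZ//; exact: rsummableZ.
Qed.

Lemma pairing_linr f (r : R) phi psi : ell1 f -> ellinfty phi -> ellinfty psi ->
  pairing f (fun g => phi g + r * psi g) = pairing f phi + r * pairing f psi.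
Proof.
move=> sf bphi bpsi; have sfp := ell1_mul sf bphi; have sfq := ell1_mul sf bpsi.
transitivity (rsum ((fun g => f g * phi g) \+ (r \*: (fun g => f g * psi g)))).
  by congr rsum; apply/funext => g; rewrite /= mulrDr mulrCA.
by rewrite rsumD ?rsumZ//; exact: rsummableZ.
Qed.

Lemma pairingZ phi (r : R) f : ellinfty phi -> ell1 f ->
  pairing (r *: f) phi = r * pairing f phi.
Proof.
move=> bphi sf; rewrite -rsumZ; last exact: ell1_mul.
by congr rsum; apply/funext => g; rewrite /= [in RHS]scalerAl.
Qed.

Lemma pairing_delta phi g : pairing (delta g) phi = phi g.
Proof.
transitivity (rsum (phi g \*: delta g)); last first.
  by rewrite rsumZ ?rsum_delta ?mulr1//; exact: rsummable_delta.
congr rsum; apply/funext => i; rewrite /delta /=.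
by case: eqVneq => [->|_]; rewrite ?mul1r ?scaler1 ?mulr1// mul0r scaler0.
Qed.

(** Hölder's inequality for the exponents one and infinity. *)
Lemma ler_abs_pairing f phi M : ell1 f -> (forall g, `|phi g| <= M) ->
  `|pairing f phi| <= M * rsum (fun g => `|f g|).
Proof.
move=> sf HM; have bphi : ellinfty phi by apply/ellinftyP; exists M.
have sfp := ell1_mul sf bphi.
apply: (le_trans (ler_abs_rsum sfp)); rewrite -rsumZ; last exact: rsummable_abs.
apply: ler_rsum => [||g /=]; first exact: rsummable_abs.
  exact/rsummableZ/rsummable_abs.
by rewrite normrM mulrC ler_wpM2r.
Qed.

Let esum_reflect (a : G -> \bar R) :
  \esum_(g in [set: G]) a (- g) = \esum_(g in [set: G]) a g.
Proof.
by rewrite [RHS](reindex_esum [set: G] [set: G] -%R)//.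
Qed.

Lemma ell1_reflect f : ell1 f -> ell1 (fun g => f (- g)).
Proof.
by rewrite /ell1 /= /summable (esum_reflect (fun g => `|(f g)%:E|%E)).
Qed.

Lemma pairing_reflect f phi :
  pairing (fun g => f (- g)) (fun g => phi (- g)) = pairing f phi.
Proof.
congr (fine _ - fine _); rewrite -[RHS]esum_reflect; apply: eq_esum => g _.
  by rewrite !funeposE.
by rewrite !funenegE.
Qed.

End pairing.

(** * Membership in the sum of the dual cones *)

Section cone_duality.
Context {R : realType} {G : zmodType} (Omegap Omegam : set G).
Hypotheses (symOmegap : symmetric_set Omegap)
  (symOmegam : symmetric_set Omegam).
Hypothesis Omegap0 : Omegap 0.
Implicit Types (f q : G -> R).
Local Notation P := (coneP R G).
Local Notation Q := (@coneQ R G Omegap Omegam).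
Local Notation norm1 f := (rsum (fun g => `|f g|)).

Lemma symmetric_setN (Omega : set G) g : symmetric_set Omega -> Omega g ->
  Omega (- g).
Proof. by move=> sO Og; rewrite sO; exists g. Qed.

Lemma coneQ_ell1 f : Q f -> ell1 f. Proof. by case. Qed.

Lemma coneQ_lin (r : R) f q : 0 <= r -> Q f -> Q q -> Q (r *: f + q).
Proof.
move=> r0 [sf fp fm] [sq qp qm]; split=> [|g gO|g gO].
- by apply: rsummableD => //; exact: rsummableZ.
- rewrite [X in X <= _](_ : _ = r * f g + q g)// -[leRHS]addr0 lerD ?qp//.
  by rewrite mulr_ge0_le0// fp.
- rewrite [X in _ <= X](_ : _ = r * f g + q g)// addr_ge0 ?qm//.
  by rewrite mulr_ge0// fm.
Qed.

Lemma coneQ0 : Q 0.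
Proof. by split=> //; exact: rsummable0. Qed.

(** A point outside [Omegap] differs from [0], which lies in [Omegap], so the Dirac function
    vanishes there; nowhere is it negative. *)
Lemma coneQ_delta0 : Q (delta 0).
Proof.
split=> [|g|g _]; first exact: rsummable_delta.
  by rewrite /delta; case: eqVneq => [->|].
by rewrite /delta.
Qed.

Lemma coneQ_reflect f : Q f -> Q (fun g => f (- g)).
Proof.
move=> [sf fp fm]; split=> [|g gO|g gO]; first exact: ell1_reflect.
- by apply: fp => /(symmetric_setN symOmegap); rewrite opprK.
- by apply: fm => /(symmetric_setN symOmegam); rewrite opprK.
Qed.

Lemma real_psd_lin (r : R) f q : 0 <= r -> real_psd f -> real_psd q ->
  real_psd (r *: f + q).
Proof.
by move=> r0 pf pq n c x; rewrite qform_lin addr_ge0// mulr_ge0.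
Qed.

Lemma real_psd0 : real_psd (0 : G -> R).
Proof.
move=> n c x; rewrite /qform big1// => k _; rewrite big1// => l _.
by rewrite mulr0.
Qed.

Lemma real_psd_delta0 f : ell1 f -> real_psd (norm1 f *: delta 0 + f).
Proof.
move=> sf; apply: real_psd_dirac => s us; apply: ler_sum_rsum => //.
exact: rsummable_abs.
Qed.

Section even_functional.
Context (phi : G -> R).
Hypotheses (bphi : ellinfty phi) (evphi : even_function phi).
Hypothesis phi_ge0 : forall f, P f -> Q f -> 0 <= pairing f phi.

(* Symmetrizing [f] lands in [P], and does not change the pairing with the even
   function [phi]. *)
Lemma psd_pairing_ge0 f : Q f -> real_psd f -> 0 <= pairing f phi.
Proof.
move=> Qf pf; pose f' g := f (- g).
have Qf' : Q f' by exact: coneQ_reflect.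
have pf' : real_psd f' by move=> n c x; rewrite qform_reflect.
have Qs : Q (1 *: f + f') by exact: coneQ_lin.
have Ps : P (1 *: f + f').
  apply: coneP_psd; first exact: coneQ_ell1.
    by move=> g; rewrite /f' scale1r /GRing.add /= opprK addrC.
  exact: real_psd_lin.
have := phi_ge0 Ps Qs.
rewrite pairing_linl//; [|exact: coneQ_ell1|exact: coneQ_ell1].
have -> : pairing f' phi = pairing f phi.
  by rewrite -(pairing_reflect f phi); congr pairing; apply/funext => g;
    rewrite evphi.
lra.
Qed.

(** [N] is the value function of the conic program under a perturbation [f] of its constraint
    [q >= 0]. The real [inf] is meaningful only for a nonempty set bounded below, which [S_ub] and
    [S_lb] ensure. *)
Let S f := [set pairing q phi | q in [set q | Q q /\ real_psd (q - f)]].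
Let N f := inf (S f).

(** The witness is [norm1 f *: delta 0], admissible by Schur's test applied to [- f], which has the
    same norm. *)
Let S_ub f : ell1 f -> S f (norm1 f * phi 0).
Proof.
move=> sf; exists (norm1 f *: delta 0); last first.
  by rewrite pairingZ ?pairing_delta//; exact: rsummable_delta.
split.
  rewrite -[_ *: _]addr0; apply: coneQ_lin => //; last exact: coneQ0.
    exact: rsum_ge0.
  exact: coneQ_delta0.
rewrite (_ : norm1 f = norm1 (- f)); last first.
  by congr rsum; apply/funext => g; rewrite -normrN.
by apply: real_psd_delta0; rewrite -scaleN1r; exact: rsummableZ.
Qed.

(** Adding [norm1 f *: delta 0 + f >= 0] to [q - f >= 0] shows that [norm1 f *: delta 0 + q], an
    element of [Q], has nonnegative forms; it therefore pairs nonnegatively with [phi]. *)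
Let S_lb f : ell1 f -> lbound (S f) (- (norm1 f * phi 0)).
Proof.
move=> sf _ [q [Qq pq] <-].
have Qd := coneQ_lin (rsum_ge0 (fun g => normr_ge0 (f g))) coneQ_delta0 Qq.
have : real_psd (norm1 f *: delta 0 + q).
  have := real_psd_lin ler01 (real_psd_delta0 sf) pq.
  by rewrite scale1r addrACA [f + - f]addrC addrA; congr real_psd;
    rewrite subrK.
move=> /(psd_pairing_ge0 Qd); rewrite pairing_linl ?pairing_delta//; first lra.
  exact: rsummable_delta.
exact: coneQ_ell1.
Qed.

Let N_le f q : ell1 f -> Q q -> real_psd (q - f) -> N f <= pairing q phi.
Proof.
move=> sf Qq pq; apply: ge_inf; last by exists q.
by exists (- (norm1 f * phi 0)); exact: S_lb.
Qed.

Let le_N f c : ell1 f ->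
  (forall q, Q q -> real_psd (q - f) -> c <= pairing q phi) -> c <= N f.
Proof.
move=> sf cS; apply: lb_le_inf; first by exists (norm1 f * phi 0); exact: S_ub.
by move=> _ [q [Qq pq] <-]; exact: cS.
Qed.

(** Admissible points for [u] and [v] add up to one for [u + v], and [a^-1] carries those for
    [a *: u] to those for [u]. *)
Let N_sublinear : sublinear_on (@ell1 R G) N.
Proof.
split=> [u v su sv|a u a0 su].
  rewrite -lerBlDr; apply: le_N => // q Qq pq; rewrite lerBlDr -lerBlDl.
  apply: le_N => // q' Qq' pq'; rewrite lerBlDl.
  have := pairing_linl 1 bphi (coneQ_ell1 Qq) (coneQ_ell1 Qq').
  rewrite mul1r => <-; apply: N_le; [exact: rsummableD|exact: coneQ_lin|].
  have := real_psd_lin ler01 pq pq'.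
  by rewrite !scale1r opprD addrACA.
have ai0 : 0 <= a^-1 by rewrite invr_ge0 ltW.
apply: le_N => [|q Qq pq]; first exact: rsummableZ.
rewrite -ler_pdivlMl// -pairingZ//; last exact: coneQ_ell1.
apply: N_le => //.
  by rewrite -[_ *: _]addr0; apply: coneQ_lin => //; exact: coneQ0.
have := real_psd_lin ai0 pq real_psd0.
by rewrite addr0 scalerBr scalerA mulVf ?lt0r_neq0// scale1r.
Qed.

Lemma even_mem_dual_sum : minkowski_sum (dual_cone P) (dual_cone Q) phi.
Proof.
have ell1_lin (a : R) (u v : G -> R) : ell1 u -> ell1 v -> ell1 (a *: u + v).
  by move=> su sv; apply: rsummableD => //; exact: rsummableZ.
have ell10 : ell1 (0 : G -> R) by exact: rsummable0.
have [L [Llin LN]] := hahn_banach ell10 ell1_lin N_sublinear.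
have L0 : L 0 = 0 by have := Llin 1 0 0 ell10 ell10; rewrite scaler0 addr0; lra.
have ell1N f : ell1 f -> ell1 (- f) by rewrite -scaleN1r; exact: rsummableZ.
have LNr f : ell1 f -> L (- f) = - L f.
  by move=> sf; have := Llin (-1) f 0 sf ell10; rewrite scaleN1r addr0 L0; lra.
have L_ub f : ell1 f -> L f <= phi 0 * norm1 f.
  move=> sf; apply: le_trans (LN _ sf) _.
  rewrite mulrC; apply: ge_inf (S_ub sf).
  by exists (- (norm1 f * phi 0)); exact: S_lb.
have L_bd f : ell1 f -> `|L f| <= phi 0 * norm1 f.
  move=> sf; rewrite ler_norml L_ub// andbT lerNl -LNr//.
  apply: le_trans (L_ub _ (ell1N _ sf)) _.
  by under eq_fun do rewrite normrN.
pose p g := L (delta g).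
have p_bd g : `|p g| <= phi 0.
  apply: le_trans (L_bd _ (rsummable_delta g)) _.
  under eq_fun do rewrite ger0_norm//.
  by rewrite rsum_delta mulr1.
have bp : ellinfty p by apply/ellinftyP; exists (phi 0).
have Lp f : ell1 f -> L f = pairing f p.
  move=> sf; apply/eqP; rewrite -subr_eq0; apply/eqP; move: f sf.
  (* The difference vanishes on Dirac functions by the choice of [p]; each of its two terms is
     bounded by [phi 0] times the norm. *)
  apply: (@rsummable_functional_eq0 _ _ (fun f => L f - pairing f p)
    (phi 0 + phi 0)).
  - by move=> a u v su sv; rewrite Llin// pairing_linl//; ring.
  - move=> f sf; apply: le_trans (ler_normB _ _) _.
    by rewrite mulrDl lerD ?L_bd//; exact: ler_abs_pairing.
  - by move=> g; rewrite pairing_delta subrr.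
(* For [c] in [P] the point [0] is admissible for [- c], so [L (- c) <= N (- c) <= 0]. *)
exists p; first split=> // c [sc pc].
  rewrite -Lp// -oppr_le0 -LNr//; apply: le_trans (LN _ (ell1N _ sc)) _.
  have <- : pairing 0 phi = 0.
    by have := pairingZ 0 bphi ell10; rewrite scale0r mul0r.
  apply: N_le; [exact: ell1N|exact: coneQ0|].
  by rewrite opprK add0r; exact: real_pd_psd.
exists (fun g => phi g + -1 * p g); last by apply/funext => g /=; ring.
split=> [|q Qq]; first exact: ellinftyD.
have sq := coneQ_ell1 Qq.
(* Each [q] in [Q] is admissible for itself, whence [L q <= N q <= pairing q phi]. *)
rewrite pairing_linr// -Lp// mulN1r subr_ge0; apply: le_trans (LN _ sq) _.
by apply: N_le => //; rewrite subrr; exact: real_psd0.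
Qed.

End even_functional.
End cone_duality.

(** * Equality of the primal and dual values *)

Theorem theorem2p1 (R : realType) (G : zmodType) (Omegap Omegam : set G)
    (rho sigma : G -> R)
    (symOmegap : symmetric_set Omegap) (symOmegam : symmetric_set Omegam)
    (Omegap0 : Omegap 0)
    (rho_bounded : ellinfty rho) (sigma_bounded : ellinfty sigma)
    (sigma_spd : strictly_positive_definite sigma)
    (rho_even : even_function rho) :
  ereal_inf [set (pairing f rho)%:E | f in
    [set f : G -> R | (coneP R G `&` coneQ Omegap Omegam) f /\
                      pairing f sigma = 1]] =
  ereal_sup [set s%:E | s in
    [set s : R | minkowski_sum (dual_cone (coneP R G))
                   (dual_cone (coneQ Omegap Omegam))
                   (fun g => rho g - s * sigma g)]].
Proof.
have [_ pdsigma possigma] := sigma_spd.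
have pairingB f s : ell1 f ->
    pairing f (fun g => rho g - s * sigma g) =
      pairing f rho - s * pairing f sigma.
  move=> sf; rewrite -mulNr -pairing_linr//.
  by congr pairing; apply/funext => g; rewrite mulNr.
apply/eqP; rewrite eq_le; apply/andP; split; last first.
  (* Weak duality: since [pairing f sigma = 1], the number [pairing f rho - s] is the pairing of [f]
     with an element of the sum of the dual cones. *)
  apply: ge_ereal_sup => _ [s [p [bp Pp] [q [bq Qq] pqE]] <-].
  apply: le_ereal_inf_tmp => _ [f [[Pf Qf] f1] <-].
  rewrite lee_fin -subr_ge0 -[s]mulr1 -f1 -pairingB; last exact: Pf.1.
  rewrite -pqE (_ : p \+ q = fun g => p g + 1 * q g); last first.
    by apply/funext => g; rewrite mul1r.
  rewrite pairing_linr//; last exact: Pf.1.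
  by rewrite mul1r addr_ge0// ?Pp// Qq.
set I := ereal_inf _; set E := [set s%:E | s in _].
(* Every real lower bound [s] of the primal values is itself dual feasible: [rho - s sigma] is
   nonnegative on both cones' intersection. *)
have attained (s : R) : (s%:E <= I)%E -> (s%:E <= ereal_sup E)%E.
  move=> sI; apply: ereal_sup_ubound; exists s => //=.
  apply: even_mem_dual_sum => //.
  - have := ellinftyD (- s) rho_bounded sigma_bounded.
    by under eq_fun do rewrite mulNr.
  - by move=> g; rewrite rho_even (real_pd_even pdsigma).
  move=> f Pf Qf; rewrite pairingB; last exact: Pf.1.
  (* The zero function cannot be normalized and is treated apart. *)
  have [->|f0] := pselect (f = cst 0).
    have p0 psi : pairing (cst 0 : G -> R) psi = 0.
      rewrite -[RHS](@rsum0 R G); congr rsum.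
      by apply/funext => g; rewrite mul0r.
    by rewrite !p0 mulr0 subrr.
  (* Dividing [f] by [c > 0] keeps it in both cones and makes it primal feasible; [s <= I] then
     gives [s * c <= pairing f rho]. *)
  have fs := possigma _ Pf f0; set c := pairing f sigma in fs *.
  have ci0 : 0 <= c^-1 by rewrite invr_ge0 ltW.
  have sf : ell1 f := Pf.1.
  rewrite subr_ge0 -ler_pdivlMr// mulrC -pairingZ// -lee_fin.
  apply: le_trans sI _; apply: ereal_inf_lbound; exists (c^-1 *: f) => //.
  split; last by rewrite pairingZ// mulVf// lt0r_neq0.
  split.
    apply: coneP_psd; first exact: rsummableZ.
      by move=> g; rewrite /GRing.scale /= (real_pd_even Pf.2).
    have := real_psd_lin ci0 (real_pd_psd Pf.2) (@real_psd0 R G).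
    by rewrite addr0.
  by rewrite -[_ *: _]addr0; apply: coneQ_lin => //; exact: coneQ0.
(* A finite [I] is itself dual feasible. If [I] is [+oo], that is, without primal feasible
   functions, every real is dual feasible and the supremum is [+oo] too. *)
case: I attained => [r|supE|_]; last exact: leNye.
  exact.
by rewrite leye_eq; apply/eqP/eq_infty => r; exact/supE/leey.
Qed.
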